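(* Let $f:[0,1]\to\mathbb{R}$ be a bounded function such that the one-sided limits $\lim_{y\uparrow x}f(y)$ and $\lim_{y\downarrow x}f(y)$ exist for all $x$ (for each $x\in[0,1]$ at which they make sense). Then $f\in SD([0,1])$.
   Context: Let $K$ be a separable metric space (here $K=[0,1]$). $DBSC(K)$ is the set of all $f:K\to\mathbb{R}$ of the form $f=u-v$ with $u,v$ bounded lower semi-continuous on $K$; its members are called $D$-functions. Equivalently (Baire), $f\in DBSC(K)$ iff there is a sequence $(\varphi_j)$ of continuous real functions on $K$ with $\sup_{k\in K}\sum_j|\varphi_j(k)|<\infty$ and $f=\sum_j\varphi_j$ pointwise; $\|f\|_D$ denotes the infimum of $\sup_{k\in K}\sum_j|\varphi_j(k)|$ over all such sequences. $DBSC(K)$ with $\|\cdot\|_D$ is a Banach algebra. A simple $D$-function is a $D$-function taking only finitely many values. $SD(K)$ (the strong $D$-functions) is the set of $f:K\to\mathbb{R}$ for which there is a sequence $(\varphi_n)$ of simple $D$-functions on $K$ with $\|f-\varphi_n\|_D\to0$. The one-sided limits are the usual ones, over $y<x$ and $y>x$ respectively. *)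

(* Defs.v *)
From mathcomp Require Import all_boot all_order all_algebra.
From mathcomp Require Import all_classical all_reals all_analysis.
Import Order.TTheory GRing.Theory Num.Theory.
Import numFieldNormedType.Exports.

Set Implicit Arguments.
Unset Strict Implicit.
Unset Printing Implicit Defensive.

Local Open Scope classical_set_scope.
Local Open Scope ring_scope.

(* A real function on a subset K of T is represented by a total function
   T -> R of which only the values on K matter: every notion below depends only
   on the restriction to K.  In [subspace K] the points of K carry the induced
   topology and the points outside K are isolated, so continuity and
   semicontinuity there are those of the restriction to K. *)

Section Dfunctions.
Context {R : realType} {T : topologicalType}.
Implicit Types (K : set T) (f u v : T -> R) (phi : nat -> T -> R).

Definition lsc_on K u : Prop :=
  lower_semicontinuous (fun x : subspace K => (u x)%:E).

Definition DBSC K f : Prop :=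
  exists u v,
    [/\ [bounded u x | x in K], [bounded v x | x in K],
        lsc_on K u, lsc_on K v & forall x, K x -> f x = u x - v x].

Definition sup_abs_sum K phi : \bar R :=
  ereal_sup [set (\sum_(0 <= j <oo) `|phi j k|%:E)%E | k in K].

Definition Drepresents K f phi : Prop :=
  [/\ forall j, {within K, continuous (phi j)},
      (sup_abs_sum K phi < +oo)%E &
      forall k, K k -> \sum_(0 <= j < n) phi j k @[n --> \oo] --> f k].

(* The infimum is +oo when f has no representing sequence; over a nonempty
   separable metric K this means exactly that f is not in DBSC K (Baire). *)
Definition Dnorm K f : \bar R :=
  ereal_inf [set sup_abs_sum K phi | phi in Drepresents K f].

Definition simple_D K f : Prop := DBSC K f /\ finite_set (f @` K).

(* Since [Dnorm] is +oo outside DBSC K, the convergence to 0 forces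
   f - phi n, hence f, to be in DBSC K for all large n. *)
Definition SD K f : Prop :=
  exists phi : nat -> T -> R,
    (forall n, simple_D K (phi n)) /\
    Dnorm K (fun x => f x - phi n x) @[n --> \oo] --> 0%E.

End Dfunctions.

(* Main.v *)
Require Import Defs.
From mathcomp Require Import all_boot all_order all_algebra.
From mathcomp Require Import all_classical all_reals all_analysis.
From mathcomp Require Import lra.
Import Order.TTheory GRing.Theory Num.Theory.
Import numFieldNormedType.Exports.
Local Open Scope classical_set_scope.
Local Open Scope ring_scope.

(** If [g] is regulated and [|g| <= M], let [J x] be the sum of the two jumps
    [|g x - g (x-)|] and [|g x - g (x+)|].  Near any point [x] the jumps at the
    other points tend to 0, so both [5 M - J] and [g + 5 M - J] are lower
    semicontinuous and nonnegative.  Their difference is [g], and writing each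
    of them as the increasing limit of its inf-convolutions with [n |x - y|]
    gives [Dnorm g <= 11 M]: on regulated functions the D-norm is equivalent to
    the sup norm.  It remains to approximate [f] uniformly by step functions,
    which are simple D-functions because they are regulated as well. *)

(** * Lower semicontinuity on a subset, and its epsilon form *)

Lemma lsc_onW (R : realType) (T : topologicalType) (K : set T) (u : T -> R) :
  lower_semicontinuous (EFin \o u) -> lsc_on K u.
Proof.
move=> lscu x a aux; have [Kx|Kx] := pselect (K x).
- have [V Vx Vu] := lscu x a aux.
  exists V => //; case: (nbhs_subspaceP K x) => // _.
  by apply: filterS Vx.
(* Off [K] the point [x] is isolated, so its singleton is a neighbourhood. *)
- exists [set x]; last by move=> y /= ->.
  by case: (nbhs_subspaceP K x) => [/Kx|_ y].
Qed.

Lemma lscP (R : realType) (T : topologicalType) (u : T -> R) :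
  lower_semicontinuous (EFin \o u) <->
  forall x e, 0 < e -> \forall y \near x, u x - e < u y.
Proof.
split=> [lscu x e e0|H x a /=].
- have [|V Vx Vu] := lscu x (u x - e); first by rewrite /= lte_fin; lra.
  by apply: filterS Vx => y /Vu; rewrite /= lte_fin.
- rewrite lte_fin => aux; exists [set y | a < u y] => //.
  by have := H x (u x - a); rewrite subKr subr_gt0; exact.
Qed.

(** * Inf-convolutions and nonnegative series of continuous functions *)

Section inf_convolution.
Context {R : realType}.
Variable u : R -> R.
Hypothesis u_ge0 : forall x, 0 <= u x.

(** For [u] nonnegative, this is the largest [n]-Lipschitz minorant of [u]. *)
Definition infconv (n : nat) (x : R) : R :=
  inf [set u y + n%:R * `|x - y| | y in setT].

Lemma infconv_has_inf n x : has_inf [set u y + n%:R * `|x - y| | y in setT].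
Proof.
split; first by exists (u x + n%:R * `|x - x|), x.
by exists 0 => _ [y _ <-]; rewrite addr_ge0// mulr_ge0.
Qed.

Lemma infconv_le n x y : infconv n x <= u y + n%:R * `|x - y|.
Proof. by apply: ge_inf; [case: (infconv_has_inf n x)|exists y]. Qed.

Lemma le_infconv n x a :
  (forall y, a <= u y + n%:R * `|x - y|) -> a <= infconv n x.
Proof.
move=> ha; apply: lb_le_inf; first by case: (infconv_has_inf n x).
by move=> _ [y _ <-].
Qed.

Lemma infconv_ge0 n x : 0 <= infconv n x.
Proof. by apply: le_infconv => y; rewrite addr_ge0// mulr_ge0. Qed.

Lemma infconv_le_fun n x : infconv n x <= u x.
Proof. by have := infconv_le n x x; rewrite subrr normr0 mulr0 addr0. Qed.

Lemma infconv_leS n x : infconv n x <= infconv n.+1 x.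
Proof.
apply: le_infconv => y; apply: le_trans (infconv_le n x y) _.
by rewrite lerD2l ler_wpM2r// ler_nat.
Qed.

Lemma infconv_lipschitz n x y : `|infconv n x - infconv n y| <= n%:R * `|x - y|.
Proof.
have H a b : infconv n a - n%:R * `|a - b| <= infconv n b.
  apply: le_infconv => z; rewrite lerBlDr.
  apply: le_trans (infconv_le n a z) _.
  rewrite -addrA lerD2l -mulrDr ler_wpM2l//.
  by rewrite [leRHS]addrC (le_trans _ (ler_normD _ _))// addrA subrK.
rewrite ler_distl; have := H x y; have := H y x; rewrite (distrC y x).
by move=> *; apply/andP; split; lra.
Qed.

Lemma continuous_infconv n : continuous (infconv n).
Proof.
move=> x; apply/cvgrPdist_le => e e0.
have d0 : 0 < e / n.+1%:R by rewrite divr_gt0.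
near=> y.
apply: le_trans (infconv_lipschitz n x y) _.
apply: (@le_trans _ _ (n.+1%:R * `|x - y|)).
  by rewrite ler_wpM2r// ler_nat.
rewrite -ler_pdivlMl// mulrC ltW//.
Unshelve. all: by end_near. Qed.

(** Points [y] within [d] of [x] have [u y > u x - e] by semicontinuity. For the others the penalty
    is at least [n * d], which exceeds [u x] once [n] is large, and [u y] is nonnegative. *)
Lemma cvg_infconv : lower_semicontinuous (EFin \o u) ->
  forall x, infconv n x @[n --> \oo] --> u x.
Proof.
move=> /lscP lscu x; apply/cvgrPdist_le => e e0.
have [d /= d0 ud] := lscu x e e0.
near=> n.
rewrite ger0_norm ?subr_ge0 ?infconv_le_fun// lerBlDr addrC -lerBlDr.
apply: le_infconv => y; have [xyd|dxy] := ltP `|x - y| d.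
  by have := ud y xyd => /= uy; rewrite ler_wpDr ?mulr_ge0// ltW.
have : u x <= n%:R * `|x - y|.
  apply: (@le_trans _ _ (n%:R * d)); last by rewrite ler_wpM2l.
  by rewrite -ler_pdivrMr//; near: n; exact: nbhs_infty_ger.
by have := u_ge0 y; lra.
Unshelve. all: by end_near. Qed.

End inf_convolution.

Lemma lsc_series (R : realType) (u : R -> R) : (forall x, 0 <= u x) ->
  lower_semicontinuous (EFin \o u) ->
  exists phi : nat -> R -> R,
    [/\ forall j, continuous (phi j), forall j x, 0 <= phi j x,
        forall n x, \sum_(0 <= j < n) phi j x <= u x &
        forall x, \sum_(0 <= j < n) phi j x @[n --> \oo] --> u x].
Proof.
move=> u0 lscu.
(* Starting the increasing sequence at 0 makes the partial sums of its differences equal to [s n],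
   and the first difference [infconv u 0] is nonnegative. *)
pose s n := if n is m.+1 then infconv u m else cst 0.
have s_le n x : s n x <= u x by case: n => [|n] //=; exact: infconv_le_fun.
have sumE n x : \sum_(0 <= j < n) (s j.+1 x - s j x) = s n x.
  by rewrite telescope_sumr// subr0.
exists (fun j x => s j.+1 x - s j x); split.
- move=> j x; apply: cvgB; first exact: continuous_infconv.
  by case: j => [|j]; [exact: cvg_cst|exact: continuous_infconv].
- move=> [|j] x; rewrite subr_ge0; [exact: infconv_ge0|exact: infconv_leS].
- by move=> n x; rewrite sumE.
- move=> x; under eq_fun do rewrite sumE.
  exact: (eq_ind _ id (cvg_infconv u u0 lscu x) _ (cvg_shiftS (s^~ x) _)).
Qed.

(** With nonnegative series [p] for [u] and [q] for [v], the differences [p j - q j] represent [g],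
    and their absolute values sum to at most [u + v]. *)
Lemma Dnorm_le (R : realType) (K : set R) (g u v : R -> R) (a b : R) :
  (forall x, 0 <= u x <= a) -> (forall x, 0 <= v x <= b) ->
  lower_semicontinuous (EFin \o u) -> lower_semicontinuous (EFin \o v) ->
  (forall x, K x -> g x = u x - v x) -> (Dnorm K g <= (a + b)%:E)%E.
Proof.
move=> ua vb lu lv gE.
have [x|p [pC p0 p_le p_cvg]] := @lsc_series R u _ lu; first by case/andP: (ua x).
have [x|q [qC q0 q_le q_cvg]] := @lsc_series R v _ lv; first by case/andP: (vb x).
pose phi j x := p j x - q j x.
have sup_le : (sup_abs_sum K phi <= (a + b)%:E)%E.
  apply: ge_ereal_sup => _ [x _ <-].
  apply: lime_le; first by apply: is_cvg_nneseries => *; rewrite lee_fin.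
  apply: nearW => n; rewrite sumEFin lee_fin.
  apply: (@le_trans _ _ (\sum_(0 <= j < n) (p j x + q j x))).
    apply: ler_sum => j _; apply: le_trans (ler_normB _ _) _.
    by rewrite !ger0_norm.
  rewrite big_split /=; apply: lerD.
    by apply: le_trans (p_le n x) _; case/andP: (ua x).
  by apply: le_trans (q_le n x) _; case/andP: (vb x).
apply: (le_trans _ sup_le); apply: ereal_inf_lbound; exists phi => //; split.
- move=> j; apply: continuous_subspaceT => x.
  by apply: cvgB; [exact: pC|exact: qC].
- by apply: (le_lt_trans sup_le); exact: ltry.
- move=> x Kx; rewrite gE//; under eq_fun do rewrite sumrB.
  by apply: cvgB; [exact: p_cvg|exact: q_cvg].
Qed.

(** * Regulated functions and gluing *)

Definition regulated {R : realType} (g : R -> R) : Prop :=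
  forall x, cvg (g y @[y --> x^'-]) /\ cvg (g y @[y --> x^'+]).

Definition regulated_on {R : realType} (a b : R) (g : R -> R) : Prop :=
  (forall x, a < x <= b -> cvg (g y @[y --> x^'-])) /\
  (forall x, a <= x < b -> cvg (g y @[y --> x^'+])).

Section glue.
Context {R : realType}.
Implicit Types (g h : R -> R) (b v x : R).

(** The value at [b] is a separate argument because the value of a regulated function at a jump is
    independent of its one-sided limits. *)
Definition glue b g v h x := if x < b then g x else if x == b then v else h x.

Lemma glue_at_left b g v h x :
  (x <= b -> cvg (g y @[y --> x^'-])) -> (b < x -> cvg (h y @[y --> x^'-])) ->
  cvg (glue b g v h y @[y --> x^'-]).
Proof.
move=> gl hl;
have [/[dup] xb /gl /cvg_ex[l gxl]|/[dup] bx /hl /cvg_ex[l hxl]] := leP x b.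
- apply/cvg_ex; exists l; apply: cvg_trans gxl; apply: near_eq_cvg.
  near=> y; rewrite /glue ifT//.
  by apply: lt_le_trans xb; near: y; exact: nbhs_left_lt.
- apply/cvg_ex; exists l; apply: cvg_trans hxl; apply: near_eq_cvg.
  have := nbhs_left_gt bx; apply: filterS => y by_.
  by rewrite /glue ltNge ltW// (gt_eqF by_).
Unshelve. all: by end_near. Qed.

Lemma glue_at_right b g v h x :
  (x < b -> cvg (g y @[y --> x^'+])) -> (b <= x -> cvg (h y @[y --> x^'+])) ->
  cvg (glue b g v h y @[y --> x^'+]).
Proof.
move=> gl hl;
have [/[dup] bx /hl /cvg_ex[l hxl]|/[dup] xb /gl /cvg_ex[l gxl]] := leP b x.
- apply/cvg_ex; exists l; apply: cvg_trans hxl; apply: near_eq_cvg.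
  near=> y; have by_ : b < y.
    by apply: le_lt_trans bx _; near: y; exact: nbhs_right_gt.
  by rewrite /glue ltNge ltW// (gt_eqF by_).
- apply/cvg_ex; exists l; apply: cvg_trans gxl; apply: near_eq_cvg.
  by have := nbhs_right_lt xb; apply: filterS => y yb; rewrite /glue yb.
Unshelve. all: by end_near. Qed.

Lemma regulated_cst v : regulated (fun=> v : R).
Proof. by move=> x; split; exact: is_cvg_cst. Qed.

Lemma regulated_glue b g v h :
  regulated g -> regulated h -> regulated (glue b g v h).
Proof.
move=> rg rh x; split.
- by apply: glue_at_left => _; [case: (rg x)|case: (rh x)].
- by apply: glue_at_right => _; [case: (rg x)|case: (rh x)].
Qed.

Lemma finite_range_glue b g v h : finite_set (range g) ->
  finite_set (range h) -> finite_set (range (glue b g v h)).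
Proof.
move=> fg fh.
apply: (@sub_finite_set _ _ (range g `|` [set v] `|` range h)).
  move=> _ [x _ <-]; rewrite /glue.
  case: ifP => _; first by left; left; exists x.
  by case: ifP => _; [left; right|right; exists x].
by rewrite !finite_setU.
Qed.

(** Freezing [g] at its end values outside the interval supplies the one-sided limits missing at [a]
    and [b], so the work can be done on the whole line. *)
Lemma regulated_clamp a b g : regulated_on a b g ->
  regulated (glue a (cst (g a)) (g a) (glue b g (g b) (cst (g b)))).
Proof.
move=> [gl gr] x; split.
- apply: glue_at_left => [_|ax]; first exact: is_cvg_cst.
  apply: glue_at_left => [xb|_]; last exact: is_cvg_cst.
  by apply: gl; rewrite ax.
- apply: glue_at_right => [_|ax]; first exact: is_cvg_cst.
  apply: glue_at_right => [xb|_]; last exact: is_cvg_cst.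
  by apply: gr; rewrite ax.
Qed.

End glue.

(** * Jumps of a bounded regulated function *)

Section jump.
Context {R : realType}.
Variables (g : R -> R) (M : R).
Hypotheses (g_regulated : regulated g) (g_le : forall x, `|g x| <= M).

Definition jump x : R :=
  `|g x - lim (g y @[y --> x^'-])| + `|g x - lim (g y @[y --> x^'+])|.

Lemma jump_ge0 x : 0 <= jump x.
Proof. by rewrite addr_ge0. Qed.

(** Both one-sided limits at [x], like [g x], lie within [d] of [l], so each of the two jumps is at
    most [2 * d]. *)
Lemma jump_le_osc (a b l d : R) x : (forall y, a < y < b -> `|l - g y| <= d) ->
  a < x < b -> jump x <= 4 * d.
Proof.
move=> gd /[dup] /gd gx /andP[ax xb].
have gdP y : a < y < b -> l - d <= g y <= l + d.
  by move=> /gd; rewrite distrC ler_distl.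
have [cl cr] := g_regulated x.
have L : l - d <= lim (g y @[y --> x^'-]) <= l + d.
  apply/andP; split; [apply: limr_ge => //|apply: limr_le => //]; near=> y;
    by have /gdP/andP[] : a < y < b by apply/andP; split;
      [near: y; exact: nbhs_left_gt|apply: lt_trans xb; near: y; exact: nbhs_left_lt].
have L' : l - d <= lim (g y @[y --> x^'+]) <= l + d.
  apply/andP; split; [apply: limr_ge => //|apply: limr_le => //]; near=> y;
    by have /gdP/andP[] : a < y < b by apply/andP; split;
      [apply: lt_trans ax _; near: y; exact: nbhs_right_gt|near: y; exact: nbhs_right_lt].
have /gdP/andP[g1 g2] : a < x < b by rewrite ax.
case/andP: L => ? ?; case/andP: L' => ? ?.
have -> : 4 * d = 2 * d + 2 * d by lra.
by apply: lerD; rewrite ler_norml; apply/andP; split; lra.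
Unshelve. all: by end_near. Qed.

Lemma jump_le x : jump x <= 4 * M.
Proof.
apply: (@jump_le_osc (x - 1) (x + 1) 0) => [y _|].
  by rewrite sub0r normrN.
by apply/andP; split; lra.
Qed.

(** On a short open interval on either side of [x], [g] is close to its one-sided limit at [x]. Any
    [y] in that interval then has a small jump by [jump_le_osc]. *)
Lemma jump_near x e : 0 < e -> \forall y \near x, y != x -> jump y < e.
Proof.
move=> e0; have d0 : 0 < e / 5 by rewrite divr_gt0.
have [/cvgr_dist_lt/(_ _ d0)[r1 /= r10 H1] /cvgr_dist_lt/(_ _ d0)[r2 /= r20 H2]] :=
  g_regulated x.
near=> y => yx.
have y1 : `|x - y| < r1 by near: y; exact: nbhsx_ballx.
have y2 : `|x - y| < r2 by near: y; exact: nbhsx_ballx.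
apply: (@le_lt_trans _ _ (4 * (e / 5))); last by lra.
move: y1 y2; rewrite ltr_distlC => /andP[y1 _]; rewrite ltr_distlC => /andP[_ y2].
have [xy|xy|xy] := ltgtP x y; last by rewrite xy eqxx in yx.
- apply: (@jump_le_osc x (x + r2) (lim (g y @[y --> x^'+]))).
    move=> z /andP[xz zr]; apply: ltW; apply: H2 => //=.
    by rewrite ltr_distlC; apply/andP; split; lra.
  by rewrite xy.
- apply: (@jump_le_osc (x - r1) x (lim (g y @[y --> x^'-]))).
    move=> z /andP[xz zr]; apply: ltW; apply: H1 => //=.
    by rewrite ltr_distlC; apply/andP; split; lra.
  by rewrite xy y1.
Unshelve. all: by end_near. Qed.

(** Approaching [x] from one side, [g] can drop below [g x] by little more than the jump on that
    side, which [jump x] dominates. *)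
Lemma fun_near x e : 0 < e -> \forall y \near x, y != x -> g x - jump x - e < g y.
Proof.
move=> e0.
have [/cvgr_dist_lt/(_ _ e0)[r1 /= r10 H1] /cvgr_dist_lt/(_ _ e0)[r2 /= r20 H2]] :=
  g_regulated x.
near=> y => yx.
have y1 : `|x - y| < r1 by near: y; exact: nbhsx_ballx.
have y2 : `|x - y| < r2 by near: y; exact: nbhsx_ballx.
rewrite /jump; set l := lim _; set l' := lim _.
have := ler_norm (g x - l); have := ler_norm (g x - l').
have := normr_ge0 (g x - l); have := normr_ge0 (g x - l').
have [xy|xy|xy] := ltgtP x y; last by rewrite xy eqxx in yx.
- by have := H2 y y2 xy; rewrite -/l' ltr_distlC => /andP[+ _]; lra.
- by have := H1 y y1 xy; rewrite -/l ltr_distlC => /andP[+ _]; lra.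
Unshelve. all: by end_near. Qed.

Lemma lsc_subr_jump c : lower_semicontinuous (EFin \o (fun x => c - jump x)).
Proof.
apply/lscP => x e e0.
apply: filterS (jump_near x e e0) => y /= Jy.
have [->|/Jy] := eqVneq y x; first lra.
by have := jump_ge0 x; lra.
Qed.

(** For [y] near but distinct from [x], [g y] exceeds [g x - jump x - e / 2] while [jump y] is below
    [e / 2]: subtracting [jump x] at [x] absorbs the possible drop of [g]. *)
Lemma lsc_add_subr_jump c :
  lower_semicontinuous (EFin \o (fun x => g x + (c - jump x))).
Proof.
apply/lscP => x e e0; have e20 : 0 < e / 2 by rewrite divr_gt0.
apply: filterS2 (jump_near x _ e20) (fun_near x _ e20) => y /= Jy gy.
have [->|/[dup] /Jy Jye /gy gye] := eqVneq y x; first lra.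
lra.
Qed.

End jump.

(** * D-norm bound and membership in [DBSC] for regulated functions *)

Lemma regulated_on_lsc_sub (R : realType) (a b M : R) (g : R -> R) :
  a <= b -> regulated_on a b g -> (forall x, a <= x <= b -> `|g x| <= M) ->
  exists u v : R -> R,
    [/\ forall x, 0 <= u x <= 6 * M, forall x, 0 <= v x <= 5 * M,
        lower_semicontinuous (EFin \o u), lower_semicontinuous (EFin \o v) &
        forall x, a <= x <= b -> g x = u x - v x].
Proof.
move=> ab rg gM.
pose h := glue a (cst (g a)) (g a) (glue b g (g b) (cst (g b))).
have rh : regulated h by exact: regulated_clamp.
have hM x : `|h x| <= M.
  rewrite /h /glue /cst; case: ltgtP => [xa|ax|xa]; try by apply: gM; rewrite lexx.
  case: ltgtP => [xb|bx|xb]; try by apply: gM; rewrite lexx ab.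
  by apply: gM; rewrite !ltW.
have hE x : a <= x <= b -> h x = g x.
  by rewrite /h /glue /cst; case: ltgtP => [//|_|->] //=; case: ltgtP => // ->.
(* Since [jump h] lies between 0 and [4 * M], the second function lies between [M] and [5 * M];
   adding [h], of absolute value at most [M], keeps the first between 0 and [6 * M]. *)
exists (fun x => h x + (5 * M - jump h x)), (fun x => 5 * M - jump h x); split.
- move=> x; have := hM x; rewrite ler_norml => /andP[h1 h2].
  have := jump_ge0 h x; have := jump_le h M rh hM x.
  by move=> ? ?; apply/andP; split; lra.
- move=> x; have := le_trans (normr_ge0 _) (hM x) => M0.
  have := jump_ge0 h x; have := jump_le h M rh hM x.
  by move=> ? ?; apply/andP; split; lra.
- exact: lsc_add_subr_jump.
- exact: lsc_subr_jump.
- by move=> x /hE <-; rewrite addrK.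
Qed.

Lemma Dnorm_regulated_le (R : realType) (a b M : R) (g : R -> R) :
  a <= b -> regulated_on a b g -> (forall x, a <= x <= b -> `|g x| <= M) ->
  (Dnorm `[a, b] g <= (11 * M)%:E)%E.
Proof.
move=> ab rg gM.
have [u [v [u0 v0 lu lv gE]]] := regulated_on_lsc_sub R a b M g ab rg gM.
have -> : 11 * M = 6 * M + 5 * M by lra.
by apply: (Dnorm_le _ _ _ u v) => // x /=; rewrite in_itv /=; exact: gE.
Qed.

Lemma Dnorm_ge0 (R : realType) (T : topologicalType) (K : set T) (f : T -> R) :
  K !=set0 -> (0 <= Dnorm K f)%E.
Proof.
move=> [k Kk]; apply: le_ereal_inf_tmp => _ [phi _ <-].
apply: le_trans (ereal_sup_ubound _); last by exists k.
exact: nneseries_ge0.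
Qed.

Lemma bounded_onP (R : realType) (T : Type) (K : set T) (f : T -> R) (M : R) :
  (forall x, K x -> `|f x| <= M) -> [bounded f x | x in K].
Proof.
move=> fM; rewrite /bounded_near; near=> N => x /fM fxM; apply: (le_trans fxM).
by near: N; apply: nbhs_pinfty_ge; exact: num_real.
Unshelve. all: by end_near. Qed.

Lemma DBSC_regulated (R : realType) (a b M : R) (g : R -> R) :
  a <= b -> regulated_on a b g -> (forall x, a <= x <= b -> `|g x| <= M) ->
  DBSC `[a, b] g.
Proof.
move=> ab rg gM.
have [u [v [u0 v0 lu lv gE]]] := regulated_on_lsc_sub R a b M g ab rg gM.
exists u, v; split.
- apply: (@bounded_onP _ _ _ _ (6 * M)) => x _.
  by case/andP: (u0 x) => ? ?; rewrite ger0_norm.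
- apply: (@bounded_onP _ _ _ _ (5 * M)) => x _.
  by case/andP: (v0 x) => ? ?; rewrite ger0_norm.
- exact: lsc_onW.
- exact: lsc_onW.
- by move=> x /=; rewrite in_itv /=; exact: gE.
Qed.

(** * Uniform approximation by step functions *)

Lemma regulated_on_locally_step (R : realType) (a b e c : R) (g : R -> R) :
  regulated_on a b g -> 0 < e -> a <= c <= b ->
  exists l l', \forall x \near c, a <= x <= b ->
    `|g x - glue c (cst l) (g c) (cst l') x| <= e.
Proof.
move=> [gl gr] e0 /andP[ac cb].
have [l Hl] : exists l, \forall x \near c, x < c -> a <= x -> `|g x - l| <= e.
  have [ltac|ltca] := ltP a c; last first.
    (* Here [c = a]: no point of the interval lies to the left of [c], so any constant will do. *)
    exists 0; near=> x => xc ax.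
    by have := lt_le_trans xc (le_trans ltca ax); rewrite ltxx.
  have /cvg_ex[l gcl] : cvg (g y @[y --> c^'-]) by apply: gl; rewrite ltac.
  have H : \forall x \near c, x < c -> `|l - g x| <= e.
    exact: cvgr_dist_le _ _ gcl _ e0.
  by exists l; near=> x => xc _; rewrite distrC; move: xc; near: x; exact: H.
have [l' Hl'] : exists l, \forall x \near c, c < x -> x <= b -> `|g x - l| <= e.
  have [ltac|ltca] := ltP c b; last first.
    exists 0; near=> x => xc xb.
    by have := lt_le_trans xc (le_trans xb ltca); rewrite ltxx.
  have /cvg_ex[l' gcl] : cvg (g y @[y --> c^'+]) by apply: gr; rewrite ac.
  have H : \forall x \near c, c < x -> `|l' - g x| <= e.
    exact: cvgr_dist_le _ _ gcl _ e0.
  by exists l'; near=> x => xc _; rewrite distrC; move: xc; near: x; exact: H.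
exists l, l'; apply: filterS2 Hl Hl' => x H H' /andP[ax xb].
rewrite /glue /cst; case: ltgtP => [xc|cx|->]; [exact: H|exact: H'|].
by rewrite subrr normr0 ltW.
Unshelve. all: by end_near. Qed.

(** Supremum argument: the set [S] of those [t] for which [g] can be approximated on [[a, t]]
    contains [a], and a local step function at [sup S] carries an approximation beyond [sup S]
    unless [b] is reached. *)
Lemma step_approximation (R : realType) (a b e : R) (g : R -> R) :
  a <= b -> regulated_on a b g -> 0 < e ->
  exists s, [/\ regulated s, finite_set (range s) &
    forall x, a <= x <= b -> `|g x - s x| <= e].
Proof.
move=> ab rg e0.
pose good t := exists s, [/\ regulated s, finite_set (range s) &
    forall x, a <= x <= t -> `|g x - s x| <= e].
have fin_cst (v : R) : finite_set (range (cst v : R -> R)).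
  by apply: (sub_finite_set _ (finite_set1 v)) => _ [x _ <-].
pose S := [set t | a <= t <= b /\ good t].
have Sa : S a.
  split; first by rewrite lexx.
  exists (cst (g a)); split; [exact: regulated_cst|exact: fin_cst|].
  by move=> x; rewrite -eq_le => /eqP ->; rewrite subrr normr0 ltW.
have ubS : has_ubound S by exists b => t [/andP[]].
have supS : has_sup S by split => //; exists a.
have acb : a <= sup S <= b.
  apply/andP; split; first exact: ub_le_sup.
  by apply: ge_sup; [exists a|move=> t [/andP[]]].
have [l [l' [r /= r0 lr]]] := regulated_on_locally_step R a b e (sup S) g rg e0 acb.
have [t [/andP[at_ tb] [s [rs fs gs]]] ct] := sup_adherent r0 supS.
have tc : t <= sup S by apply: ub_le_sup => //; split; [rewrite at_|exists s].
(* Halving [r] keeps [t1] strictly inside the ball where the local step function is valid. Once [t1]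
   is in [S], it cannot exceed [sup S], which forces [t1 = b]. *)
pose t1 := Num.min b (sup S + r / 2).
case/andP: acb => ac cb.
have t1b : t1 <= b by rewrite /t1 ge_min lexx.
have t1r : t1 <= sup S + r / 2 by rewrite /t1 ge_min lexx orbT.
have St1 : S t1.
  split; first by rewrite t1b andbT /t1 le_min ab /=; lra.
  (* The old approximation [s] serves before [t], the exact value at [t], and the local step
     function around [sup S] after [t], which is legitimate because [t > sup S - r]. *)
  exists (glue t s (g t) (glue (sup S) (cst l) (g (sup S)) (cst l'))); split.
  - by do 2?apply: regulated_glue => //; exact: regulated_cst.
  - by do 2?apply: finite_range_glue => //; exact: fin_cst.
  move=> x /andP[ax xt1]; rewrite {1}/glue; case: ltgtP => [xt|tx|->].
  - by apply: gs; rewrite ax ltW.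
  - apply: lr; last by rewrite ax (le_trans xt1).
    by rewrite /= ltr_distlC; apply/andP; split; lra.
  - by rewrite subrr normr0 ltW.
have t1c : t1 <= sup S by exact: ub_le_sup.
have t1E : t1 = b.
  apply/le_anti; rewrite t1b leNgt; apply/negP => t1_lt.
  by move: t1_lt t1c; rewrite /t1 gt_min ltxx ge_min /=; lra.
by move: St1; rewrite t1E => -[].
Qed.

Theorem mainTheorem5 (R : realType) (f : R -> R)
  (f_bounded : [bounded f x | x in `[0, 1]])
  (f_left : forall x : R, x \in `]0, 1] -> cvg (f y @[y --> x^'-]))
  (f_right : forall x : R, x \in `[0, 1[ -> cvg (f y @[y --> x^'+])) :
  SD (`[0, 1] : set R) f.
Proof.
have rf : regulated_on 0 1 f.
  by split=> x x01; [apply: f_left|apply: f_right]; rewrite in_itv.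
have [M fM] : exists M : R, forall x, 0 <= x <= 1 -> `|f x| <= M.
  (* Boundedness is stated for all bounds strictly above [M], hence the choice of [M + 1]. *)
  have [M [_ HM]] := f_bounded; exists (M + 1) => x x01.
  by apply: (HM (M + 1)); [rewrite ltrDl|rewrite /= in_itv].
have /choice[s sP] : forall n : nat, exists s, [/\ regulated s,
    finite_set (range s) & forall x, 0 <= x <= 1 -> `|f x - s x| <= harmonic n].
  by move=> n; apply: step_approximation => //; exact: harmonic_gt0.
have rs n : regulated_on 0 1 (s n).
  by case: (sP n) => sn _ _; split=> x _; case: (sn x).
exists s; split.
- move=> n; have [_ fin_s fs] := sP n; split.
    (* [s n] inherits a bound on the unit interval from [f] and the approximation error. *)
    apply: (@DBSC_regulated _ _ _ (M + harmonic n)) => // x x01.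
    have -> : s n x = f x - (f x - s n x) by rewrite subKr.
    by apply: le_trans (ler_normB _ _) _; apply: lerD; [exact: fM|exact: fs].
  by apply: sub_finite_set fin_s => _ [x _ <-]; exists x.
(* The error [f - s n] is itself regulated and at most [harmonic n] in absolute value, so its D-norm
   is at most [11 * harmonic n], which tends to 0. *)
- apply: (@squeeze_cvge _ _ _ _ (cst 0%E) _ (fun n => (11 * harmonic n)%:E)).
  + apply: nearW => n; have [_ _ fs] := sP n; apply/andP; split.
      by apply: Dnorm_ge0; exists 0; rewrite /= in_itv /= lexx ler01.
    apply: Dnorm_regulated_le => //; case: rf (rs n) => fl fr [sl sr].
    by split=> x x01; apply: is_cvgB; [exact: fl|exact: sl|exact: fr|exact: sr].
  + exact: cvg_cst.
  + apply: cvg_EFin; first exact: nearW.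
    rewrite -[X in _ --> X](mulr0 11).
    by apply: cvgM; [exact: cvg_cst|exact: cvg_harmonic].
Qed.
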